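(* Let $K$ be a number field with ring of integers $O_K$. Let $f(x)=x^d+c_1/c_2$, $d\ge 2$, where $c_1,c_2\in O_K$ are relatively prime in $O_K$, $c_2\neq 0$. Let $u_1/u_2$ be a periodic point of $f(x)$, where $u_1,u_2\in O_K$ are relatively prime in $O_K$, $u_2\ne 0$. Then $c_2=u_2^d$, where $c_2$ and $u_2$ are regarded modulo units of $O_K$ (that is, $c_2$ and $u_2^d$ are equal up to multiplication by a unit of $O_K$).
   Context: The iterates of $f$ are $f^1=f$ and $f^m(x)=f(f^{m-1}(x))$ for $m\ge 2$. A point $u\in K$ is a periodic point of $f$ if $f^n(u)=u$ for some $n\ge1$. The paper takes the denominators $c_2$ and $u_2$ as elements of $O_K/O_K^{\times}$, i.e. they are only considered modulo the group of units $O_K^\times$. *)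

(* Defs.v *)
From HB Require Import structures.
From mathcomp Require Import all_boot all_order all_algebra all_field.
Set Implicit Arguments.
Unset Strict Implicit.
Unset Printing Implicit Defensive.
Import GRing.Theory.
Local Open Scope ring_scope.

(* A number field is a finite extension K of rat; O_K is the integral closure
   of the image of int in K, given as a predicate on K. *)
Definition in_OK (K : fieldExtType rat) (x : K) : Prop :=
  integralOver (intr : int -> K) x.

(* x is a unit of the ring O_K, not merely of the field K. *)
Definition OK_unit (K : fieldExtType rat) (x : K) : Prop :=
  in_OK x /\ exists2 y : K, in_OK y & x * y = 1.

(* The ideals (a) and (b) satisfy (a) + (b) = O_K. When O_K is not a PID this is
   stronger than having no common non-unit divisor in O_K. *)
Definition OK_coprime (K : fieldExtType rat) (a b : K) : Prop :=
  exists r s : K, [/\ in_OK r, in_OK s & r * a + s * b = 1].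

Definition OK_eq_mod_units (K : fieldExtType rat) (a b : K) : Prop :=
  exists2 e : K, OK_unit e & a = e * b.

Definition periodic_point (T : Type) (f : T -> T) (u : T) : Prop :=
  exists2 n : nat, (1 <= n)%N & iter n f u = u.

(* Main.v *)
Require Import Defs.
From HB Require Import structures.
From mathcomp Require Import all_boot all_order all_algebra all_field.
From mathcomp Require Import ring.
Set Implicit Arguments.
Unset Strict Implicit.
Unset Printing Implicit Defensive.
Import GRing.Theory.
Local Open Scope ring_scope.

(** Write [c = c1 / c2], [f x = x ^+ d + c] and [x = u1 / u2].  One prime at a
    time the theorem is a remark about valuations: on a finite orbit the smallest
    valuation [m] satisfies [m >= min (0, v c / d)], since a smaller value would
    be multiplied by [d] at the next step; and when [v c < 0] the bound at [f x]
    forces [x ^+ d] and [c] to have the same valuation, since [x ^+ d + c] has a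
    larger valuation than [c].  So [x ^+ d] and [c] have the same denominator.

    The proof below replaces valuations by integrality, so that no ideal has to
    be factored.

    - The lower bound on [v x] becomes the integrality of [c2 * x ^+ d] for every
      periodic [x] ([periodic_scaled_power_integral]).  Multiplying the [k]-th
      iterate of [x] by a suitable power of [c2] gives a monic integral polynomial
      in [w = c2 * x ^+ d] ([iter_monic_in_scaled_power]); closing the cycle turns
      it into a monic integral equation for [w].
    - The bound [d * v x <= v c] becomes the integrality of [u2 ^+ d * c]
      ([periodic_denominator_clears_constant]).  It comes from the previous point
      applied to [f x], which is periodic too: the resulting bound on [f x] is
      so good that [(t + u1 ^+ d) ^+ d], where [t = u2 ^+ d * c], equals a
      linear expression in [t] with integral coefficients.

    Since both fractions are in lowest terms, these two facts say that [u2 ^+ d]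
    divides [c2] and that [c2] divides [u2 ^+ d]. *)

(** * Integral elements and polynomials with integral coefficients *)

Section IntegralElements.

Variable K : fieldExtType rat.
Implicit Types (a b u w : K) (p q : {poly K}).

Lemma in_OK1 : in_OK (1 : K).
Proof. exact: integral1. Qed.

Lemma in_OKD a b : in_OK a -> in_OK b -> in_OK (a + b).
Proof. exact: integral_add. Qed.

Lemma in_OKM a b : in_OK a -> in_OK b -> in_OK (a * b).
Proof. exact: integral_mul. Qed.

Lemma in_OKX a n : in_OK a -> in_OK (a ^+ n).
Proof.
move=> Oa; elim: n => [|n IHn]; first by rewrite expr0; apply: in_OK1.
by rewrite exprS; apply: in_OKM.
Qed.

Definition OK_poly p := forall i, in_OK p`_i.

Lemma OK_polyC a : in_OK a -> OK_poly a%:P.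
Proof. by move=> Oa i; rewrite coefC; case: eqP => // _; apply: integral0. Qed.

Lemma OK_polyX : OK_poly 'X.
Proof. by move=> i; rewrite coefX; apply: integral_nat. Qed.

Lemma OK_polyD p q : OK_poly p -> OK_poly q -> OK_poly (p + q).
Proof. by move=> Op Oq i; rewrite coefD; apply: in_OKD. Qed.

Lemma OK_polyM p q : OK_poly p -> OK_poly q -> OK_poly (p * q).
Proof.
move=> Op Oq i; rewrite coefM; apply: (big_ind (@in_OK K)).
- exact: integral0.
- exact: in_OKD.
- by move=> j _; apply: in_OKM.
Qed.

Lemma OK_polyXn p n : OK_poly p -> OK_poly (p ^+ n).
Proof.
move=> Op; elim: n => [|n IHn]; first by rewrite expr0; apply/OK_polyC/in_OK1.
by rewrite exprS; apply: OK_polyM.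
Qed.

(** The form in which monic equations arise below: a monic leading part, with
    everything of lower degree collected on the other side. *)
Lemma in_OK_monic_eq p q w :
    p \is monic -> OK_poly p -> OK_poly q -> (size q < size p)%N ->
    p.[w] = q.[w] -> in_OK w.
Proof.
move=> p_mon Op Oq ltqp pq_w.
have r_mon : p - q \is monic.
  by rewrite monicE lead_coefDl ?size_polyN // -monicE.
apply: (integral_root_monic r_mon).
  by rewrite /root hornerD hornerN pq_w subrr.
apply/integral_poly=> i; rewrite coefD coefN.
exact: (integral_sub (Op i) (Oq i)).
Qed.

Lemma OK_coprimeMl a b c :
  in_OK a -> in_OK c -> OK_coprime a c -> OK_coprime b c -> OK_coprime (a * b) c.
Proof.
move=> Oa Oc [r [s [Or Os E]]] [r' [s' [Or' Os' E']]].
exists (r * r'), (r * a * s' + s); split.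
- exact: in_OKM.
- by apply: in_OKD => //; apply: in_OKM => //; apply: in_OKM.
- rewrite -E -[r * a in RHS]mulr1 -E'; ring.
Qed.

Lemma OK_coprime_sym a b : OK_coprime a b -> OK_coprime b a.
Proof. by move=> [r [s [Or Os E]]]; exists s, r; rewrite addrC. Qed.

Lemma OK_coprimeXl a c n :
  in_OK a -> in_OK c -> OK_coprime a c -> OK_coprime (a ^+ n) c.
Proof.
move=> Oa Oc cop; elim: n => [|n IHn].
  by exists 1, 0; rewrite expr0 mul0r addr0 mulr1; split;
     [apply: in_OK1 | apply: integral0 |].
by rewrite exprS; apply: OK_coprimeMl.
Qed.

Lemma OK_coprimeX a b n :
  in_OK a -> in_OK b -> OK_coprime a b -> OK_coprime (a ^+ n) (b ^+ n).
Proof.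
move=> Oa Ob cop; apply: OK_coprimeXl => //; first exact: in_OKX.
by apply/OK_coprime_sym/OK_coprimeXl/OK_coprime_sym.
Qed.

(** The denominators of a fraction form an ideal, and for a fraction in lowest
    terms the Bezout relation makes this ideal principal, generated by [b]. *)
Lemma lowest_terms_denominator a b e :
    in_OK e -> b != 0 -> OK_coprime a b -> in_OK (e * (a / b)) ->
  in_OK (e / b).
Proof.
move=> Oe b0 [r [s [Or Os E]]] Oeab.
suff -> : e / b = r * (e * (a / b)) + s * e.
  by apply: in_OKD; apply: in_OKM.
by rewrite -[LHS]mulr1 -E; field.
Qed.

End IntegralElements.

(** * Periodic points *)

Lemma periodic_image (T : Type) (f : T -> T) (u : T) :
  periodic_point f u -> periodic_point f (f u).
Proof. by move=> [n n_gt0 En]; exists n => //; rewrite -iterSr iterS En. Qed.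

Section UnicriticalPeriodicPoints.

Variables (K : fieldExtType rat) (d : nat) (c1 c2 : K).
Hypotheses (d_ge2 : (2 <= d)%N) (Oc1 : in_OK c1) (Oc2 : in_OK c2).
Hypothesis c2_neq0 : c2 != 0.

Let f (x : K) := x ^+ d + c1 / c2.

(** Each application of [f] raises the denominator to the power [d], and this
    absorbs the single new factor [c2] coming from the constant term.  The
    polynomials are [B_0 = 'X + c1] and
    [B_k.+1 = B_k ^+ d + c2 ^+ (d ^ k.+1 - 1) * c1]. *)
Lemma iter_monic_in_scaled_power (x : K) (k : nat) :
  exists B : {poly K}, [/\ B \is monic, size B = (d ^ k).+1, OK_poly B &
    B.[c2 * x ^+ d] = c2 ^+ (d ^ k) * iter k.+1 f x].
Proof.
elim: k => [|k [B [Bmon szB OB EB]]].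
  exists ('X + c1%:P); split.
  - by rewrite -[c1]opprK polyCN monicXsubC.
  - by rewrite size_XaddC.
  - by apply: OK_polyD; [apply: OK_polyX | apply: OK_polyC].
  - by rewrite hornerD hornerX hornerC /f /= expr1 mulrDr mulrCA divff ?mulr1.
have d_gt0 : (0 < d)%N by apply: ltnW.
have szBd : size (B ^+ d) = (d ^ k.+1).+1.
  rewrite -[LHS]prednK ?size_poly_gt0 ?monic_neq0 ?rpredX //.
  by rewrite size_exp szB expnSr.
have lt_c : (size (c2 ^+ (d ^ k.+1).-1 * c1)%:P < size (B ^+ d))%N.
  by rewrite szBd ltnS (leq_trans (size_polyC_leq1 _)) // expn_gt0 d_gt0.
exists (B ^+ d + (c2 ^+ (d ^ k.+1).-1 * c1)%:P); split.
- by rewrite monicE lead_coefDl // -monicE rpredX.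
- by rewrite size_polyDl.
- by apply: OK_polyD; [apply: OK_polyXn | apply/OK_polyC/in_OKM/Oc1/in_OKX].
- have -> : iter k.+2 f x = iter k.+1 f x ^+ d + c1 / c2 by [].
  rewrite hornerD horner_exp hornerC EB [RHS]mulrDr exprMn -exprM -expnSr.
  congr (_ + _).
  rewrite -[in RHS](@prednK (d ^ k.+1)) ?expn_gt0 ?d_gt0 // exprSr.
  by field.
Qed.

(** If [x] returns to itself after [k.+1] steps, the polynomial [B] of the
    previous lemma satisfies [B(w) = c2 ^+ (d ^ k) * x] at [w = c2 * x ^+ d];
    its [d]-th power is [c2 ^+ (d ^ k.+1 - 1) * w], which is linear in [w]. *)
Lemma periodic_scaled_power_integral (x : K) :
  periodic_point f x -> in_OK (c2 * x ^+ d).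
Proof.
move=> [[|k] // _ Ex].
have [B [Bmon szB OB EB]] := iter_monic_in_scaled_power x k.
have d_gt0 : (0 < d)%N by apply: ltnW.
apply: (@in_OK_monic_eq K (B ^+ d) ((c2 ^+ (d ^ k.+1).-1)%:P * 'X)).
- exact: rpredX.
- exact: OK_polyXn.
- by apply: OK_polyM; [apply/OK_polyC/in_OKX | apply: OK_polyX].
- rewrite -[X in (_ < X)%N]prednK ?size_poly_gt0 ?monic_neq0 ?rpredX //.
  rewrite size_exp szB -expnSr mul_polyC ltnS.
  rewrite (leq_trans (size_scale_leq _ _)) // size_polyX.
  by rewrite (leq_trans d_ge2) // expnS leq_pmulr // expn_gt0 d_gt0.
- rewrite horner_exp hornerM hornerC hornerX EB Ex exprMn -exprM -expnSr mulrA.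
  by rewrite -exprSr prednK // expn_gt0 d_gt0.
Qed.

Variables (u1 u2 : K).
Hypotheses (cop_c : OK_coprime c1 c2) (Ou1 : in_OK u1) (Ou2 : in_OK u2).
Hypothesis u2_neq0 : u2 != 0.

(** Put [x = u1 / u2], [y = f x] and [t = u2 ^+ d * c].  Then
    [u2 ^+ d * y = t + u1 ^+ d], while [y ^+ d = w / c2 = w * (r * c + s)] with
    [w = c2 * y ^+ d] integral and [r * c1 + s * c2 = 1].  Comparing the two
    values of [(u2 ^+ d * y) ^+ d] equates a monic polynomial of degree [d] in [t]
    with a linear one. *)
Lemma periodic_denominator_clears_constant :
  periodic_point f (u1 / u2) -> in_OK (u2 ^+ d * (c1 / c2)).
Proof.
move=> per_x; have := periodic_scaled_power_integral (periodic_image per_x).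
set y := f _; set w := c2 * _ => Ow.
have [r [s [Or Os E]]] := cop_c.
set t := u2 ^+ d * _.
have Eu : u2 ^+ d * y = t + u1 ^+ d.
  rewrite /y /f mulrDr addrC expr_div_n; congr (_ + _).
  by rewrite mulrCA divff ?mulr1 // expf_neq0.
have Ey : y ^+ d = w * (r * (c1 / c2) + s).
  rewrite -[LHS]mulr1 -E /w; field; exact: c2_neq0.
have d_gt0 : (0 < d)%N by apply: ltnW.
have monP : 'X + (u1 ^+ d)%:P \is @monic K.
  by rewrite -[u1 ^+ d]opprK polyCN monicXsubC.
pose e := w * u2 ^+ (d * d.-1).
have Oe : in_OK e by apply: in_OKM => //; apply: in_OKX.
apply: (@in_OK_monic_eq K (('X + (u1 ^+ d)%:P) ^+ d)
                          ((e * r)%:P * 'X + (e * (s * u2 ^+ d))%:P)).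
- exact: rpredX.
- apply/OK_polyXn/OK_polyD; first exact: OK_polyX.
  exact/OK_polyC/in_OKX.
- apply: OK_polyD; last by apply/OK_polyC/in_OKM/in_OKM/in_OKX.
  by apply: OK_polyM; [apply/OK_polyC/in_OKM | apply: OK_polyX].
- rewrite -[X in (_ < X)%N]prednK ?size_poly_gt0 ?monic_neq0 ?rpredX //.
  rewrite size_exp size_XaddC mul1n ltnS (leq_trans _ d_ge2) //.
  rewrite size_MXaddC; case: ifP => // _.
  by rewrite ltnS size_polyC_leq1.
- rewrite horner_exp !(hornerD, hornerM, hornerX, hornerC) -Eu exprMn Ey /e /t.
  have -> : (u2 ^+ d) ^+ d = u2 ^+ (d * d.-1) * u2 ^+ d.
    by rewrite -exprM -exprD -mulnSr prednK.
  ring.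
Qed.

End UnicriticalPeriodicPoints.

Theorem theorem4p3 (K : fieldExtType rat) (d : nat) (c1 c2 u1 u2 : K)
  (hd : (2 <= d)%N)
  (hc1 : in_OK c1) (hc2 : in_OK c2) (hc : OK_coprime c1 c2) (hc20 : c2 <> 0)
  (hu1 : in_OK u1) (hu2 : in_OK u2) (hu : OK_coprime u1 u2) (hu20 : u2 <> 0)
  (hper : periodic_point (fun x : K => x ^+ d + c1 / c2) (u1 / u2)) :
  OK_eq_mod_units c2 (u2 ^+ d).
Proof.
move/eqP: hc20 => c2_neq0; move/eqP: hu20 => u2_neq0.
have ud_neq0 : u2 ^+ d != 0 by rewrite expf_neq0.
have u_dvd_c : in_OK (c2 / u2 ^+ d).
  apply: (lowest_terms_denominator hc2 ud_neq0 (OK_coprimeX d hu1 hu2 hu)).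
  by rewrite -expr_div_n; apply: (periodic_scaled_power_integral hd hc1 hc2).
have c_dvd_u : in_OK (u2 ^+ d / c2).
  apply: (lowest_terms_denominator (in_OKX d hu2) c2_neq0 hc).
  exact: (periodic_denominator_clears_constant hd hc1 hc2 c2_neq0 hc hu1 hu2).
exists (c2 / u2 ^+ d); last by rewrite divfK.
split=> //; exists (u2 ^+ d / c2) => //.
by rewrite mulrA divfK // divff.
Qed.
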